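(* Let $t$ and $w_1,\ldots,w_t$ be fixed positive integers such that either $t\ge 3$, or $t=2$ and $\min\{w_1,w_2\}\ge 2$. Put $u=\sum_{i=1}^t w_i$. If there exists an $SHF(u;n,q,\{w_1,\ldots,w_t\})$, then $n=o(q^2)$ as $q\to\infty$. That is, for every $\epsilon>0$ there is $q_0$ (depending only on $\epsilon,w_1,\ldots,w_t$) such that for every $q\ge q_0$ every $SHF(u;n,q,\{w_1,\ldots,w_t\})$ satisfies $n\le \epsilon q^2$.
   Context: An $SHF(N;n,q,\{w_1,\ldots,w_t\})$ (separating hash family of type $\{w_1,\ldots,w_t\}$, a multiset) is a family $\mathcal{F}$ of $N$ functions $f:X\to Y$, with $|X|=n$, $|Y|=q$, such that for all pairwise disjoint subsets $C_1,\ldots,C_t\subseteq X$ with $|C_i|=w_i$ for $1\le i\le t$, there is at least one $f\in\mathcal{F}$ for which $f(C_1),\ldots,f(C_t)$ are pairwise disjoint. Equivalently, it is an $N\times n$ matrix over $q$ symbols (rows indexed by functions, columns by elements of $X$) such that any pairwise disjoint column sets $C_1,\ldots,C_t$ of sizes $w_1,\ldots,w_t$ are separated by some row, i.e. the sets of entries of $C_1,\ldots,C_t$ in that row are pairwise disjoint. *)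

(* Defs.v *)
From mathcomp Require Import all_boot.

Set Implicit Arguments.
Unset Strict Implicit.
Unset Printing Implicit Defensive.

Definition pairwise_disjoint (T : finType) (t : nat) (C : 'I_t -> {set T}) :
  Prop := forall i j : 'I_t, i != j -> [disjoint C i & C j].

Definition separates (X Y : finType) (t : nat) (f : X -> Y)
    (C : 'I_t -> {set X}) : Prop :=
  pairwise_disjoint (fun i => f @: C i).

(* [is_SHF n q w F] : the family [F] is an SHF(N; n, q, {w_1, ..., w_t}).     *)
(* The family is indexed by ['I_N], so a function may be repeated, as a row   *)
(* may be in the N x n matrix representation. The multiset of sizes is given  *)
(* by a tuple; the order of its entries is irrelevant.                        *)
Definition is_SHF (N n q t : nat) (w : t.-tuple nat) (X Y : finType)
    (F : 'I_N -> X -> Y) : Prop :=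
  [/\ #|X| = n, #|Y| = q &
      forall C : 'I_t -> {set X},
        (forall i : 'I_t, #|C i| = tnth w i) -> pairwise_disjoint C ->
        exists k : 'I_N, separates (F k) C].

(* Main.v *)
Require Import Defs.
From mathcomp Require Import all_boot all_order all_algebra.
From mathcomp Require Import reals.
From mathcomp Require Import ring lra zify.

Set Implicit Arguments.
Unset Strict Implicit.
Unset Printing Implicit Defensive.

Import Order.TTheory GRing.Theory Num.Theory.

Local Open Scope ring_scope.

(* Call a column frequent if each of its entries occurs at least u times in   *)
(* its row; all but O(q) columns are frequent. A few columns placed in the    *)
(* classes C_i, with as many rows as columns in which two classes collide,    *)
(* extend to an unseparated family: each further column is chosen to collide  *)
(* in one new row with a frequent column of another class. Hence two frequent *)
(* columns agree in at most one row, there is no triangle of columns a, b, c  *)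
(* colliding pairwise in three distinct rows if t >= 3, and no such 4-cycle   *)
(* if t = 2.                                                                  *)
(* Triangles are found by the Ruzsa-Szemeredi (6,3) argument: three rows turn *)
(* the frequent columns into the edges of a properly coloured bipartite graph *)
(* on Y + Y, coloured by the first row. Starting from trivial partitions of   *)
(* the two sides, if every edge has boundedly many colours present at both of *)
(* its ends, then for a typical edge of colour x in the cell (B, C) the set   *)
(* of ends of x-coloured edges in B and that in C span a much sparser         *)
(* rectangle than the cell, and refining by one such rectangle per cell       *)
(* decreases the distance of the graph to the step functions by a fixed       *)
(* proportion of q^2.                                                         *)
(* For the 4-cycle this is used twice: the edges closed by many colours of    *)
(* row 1 are dense, so among them one is closed by a new colour of row 4, and *)
(* then a generic colour of row 1 completes the cycle.                        *)

(** The number u of rows is the sum of the class sizes, so there is no slack: once the covered rows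
    are as many as the assigned columns, [no_configuration] fills the classes, each new column
    spoiling a new row, until no row separates. It remains to find a forbidden configuration among
    any c q^2 frequent columns.

    The engine is [increment]: if every edge is closed by at most m colours, some refinement lowers
    the squared L2 distance to step functions by a constant times q^2. That distance is at most q^2
    at the start, so [dense_proper_colouring_closing] yields an edge closed by more than m colours.
    One extra closing colour gives a triangle; two applications give a 4-cycle. *)

Lemma card_by_key (R : realFieldType) (T L : finType) (S : {set T})
    (key : T -> L) (M : L -> R) :
  (forall v, #|[set p in S | key p == v]|%:R <= M v) ->
  #|S|%:R <= \sum_v M v.
Proof.
move=> le_M; rewrite -sum1_card (partition_big key xpredT) //= natr_sum.
apply: ler_sum => v _; apply: le_trans (le_M v); rewrite -sum1_card.
by rewrite (eq_bigl (fun p => (p \in [set p in S | key p == v]))) // => p; rewrite inE.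
Qed.

(** * Properly coloured bipartite graphs *)

Section ProperColouring.

Variables (Y : finType) (D : {set Y * Y}) (f : Y * Y -> Y).

Definition left_ends x := [set y | [exists z, ((y, z) \in D) && (f (y, z) == x)]].
Definition right_ends x := [set z | [exists y, ((y, z) \in D) && (f (y, z) == x)]].
(** The colour of an edge of [D] always closes it. Another colour x gives two x-coloured edges, one
    at each end: a triangle of columns. *)
Definition closing p := [set x | (p.1 \in left_ends x) && (p.2 \in right_ends x)].
Definition proper_colouring :=
  {in D &, forall p p', f p = f p' -> p.1 = p'.1 \/ p.2 = p'.2 -> p = p'}.

Lemma mem_left_ends p : p \in D -> p.1 \in left_ends (f p).
Proof. by case: p => y z Dp; rewrite inE; apply/existsP; exists z; rewrite Dp /=. Qed.

Lemma mem_right_ends p : p \in D -> p.2 \in right_ends (f p).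
Proof. by case: p => y z Dp; rewrite inE; apply/existsP; exists y; rewrite Dp /=. Qed.

End ProperColouring.

(** * Refining partitions by sparse rectangles *)

Section Increment.

Variables (R : realFieldType) (Y K : finType) (D : {set Y * Y}) (f : Y * Y -> Y).
Variables (c1 c2 : Y -> K) (a : R) (m : nat).
Hypotheses (a_gt0 : 0 < a) (m_gt0 : (0 < m)%N) (f_proper : proper_colouring D f).
Hypothesis (few_closing : forall p, p \in D -> (#|closing D f p| <= m)%N).

Let q : R := #|Y|%:R.
Let key (p : Y * Y) := (c1 p.1, c2 p.2).
Let cell v := [set p | key p == v].
Let N1 x j := [set y in left_ends D f x | c1 y == j].
Let N2 x k := [set z in right_ends D f x | c2 z == k].
Let W x v := [set p in cell v | (p.1 \in left_ends D f x) && (p.2 \in right_ends D f x)].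

Let card_cell v : #|cell v| = (#|[set y | c1 y == v.1]| * #|[set z | c2 z == v.2]|)%N.
Proof.
by rewrite -cardsX; congr #|pred_of_set _|; apply/setP => -[y z]; rewrite !inE /key /= -pair_eqE.
Qed.

Let card_W x v : #|W x v| = (#|N1 x v.1| * #|N2 x v.2|)%N.
Proof.
rewrite -cardsX; congr #|pred_of_set _|; apply/setP => -[y z].
by rewrite !inE /key /= -pair_eqE /=; case: (c1 y == _) => //=; rewrite ?andbF ?andbT //; 
   case: (c2 z == _); rewrite ?andbF ?andbT.
Qed.

Let sum_card_fibre (T L : finType) (k : T -> L) : \sum_v #|[set y | k y == v]| = #|T|.
Proof.
rewrite -[RHS]sum1_card (partition_big k xpredT) //=.
by apply: eq_bigr => v _; rewrite -sum1_card; apply: eq_bigl => p; rewrite inE.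
Qed.

Let sparse := [set p in D | #|D :&: cell (key p)|%:R < a * #|cell (key p)|%:R].

Let card_sparse : #|sparse|%:R <= a * q ^+ 2.
Proof.
have -> : a * q ^+ 2 = \sum_v a * #|cell v|%:R.
  by rewrite -mulr_sumr -natr_sum sum_card_fibre card_prod natrM expr2.
apply: (card_by_key (key := key)) => v.
have [->|/set0Pn[p]] := eqVneq [set p in sparse | key p == v] set0.
  by rewrite cards0 mulr_ge0 // ltW.
rewrite inE => /andP[]; rewrite inE => /andP[_] + /eqP key_p; rewrite key_p => /ltW.
apply: le_trans; rewrite ler_nat; apply: subset_leq_card; apply/subsetP => p'.
by rewrite !inE => /andP[/andP[-> _] ->].
Qed.

Let left_inj : {in D &, forall p p', f p = f p' -> p.1 = p'.1 -> p = p'}.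
Proof. by move=> p p' Dp Dp' fpp' e; apply: f_proper => //; left. Qed.

Let right_inj : {in D &, forall p p', f p = f p' -> p.2 = p'.2 -> p = p'}.
Proof. by move=> p p' Dp Dp' fpp' e; apply: f_proper => //; right. Qed.

Let card_same_key (pr : Y * Y -> Y) (ends : Y -> {set Y}) (c : Y -> K) (S : {set Y * Y}) x j :
  {in D &, forall p p', f p = f p' -> pr p = pr p' -> p = p'} ->
  (forall p, p \in D -> pr p \in ends (f p)) ->
  (forall p, p \in S -> [/\ p \in D, f p = x & c (pr p) = j]) ->
  (#|S| <= #|[set y in ends x | c y == j]|)%N.
Proof.
move=> pr_inj pr_ends SP.
rewrite -(card_in_imset (f := pr) (D := S)) => [|p1 p2 /SP[D1 f1 _] /SP[D2 f2 _] e].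
  apply/subset_leq_card/subsetP => y /imsetP[p /SP[Dp <- <-] ->].
  by rewrite inE eqxx andbT pr_ends.
by apply: pr_inj => //; rewrite f1 f2.
Qed.

(** Edges of one colour have distinct ends, so a poor pair of colour x and part j carries at most a
    times the size of the part. Summing over x and j gives a q^2. *)
Let card_poor (pr : Y * Y -> Y) (ends : Y -> {set Y}) (c : Y -> K) :
  {in D &, forall p p', f p = f p' -> pr p = pr p' -> p = p'} ->
  (forall p, p \in D -> pr p \in ends (f p)) ->
  #|[set p in D | #|[set y in ends (f p) | c y == c (pr p)]|%:R <
     a * #|[set y | c y == c (pr p)]|%:R]|%:R <= a * q ^+ 2.
Proof.
move=> pr_inj pr_ends.
have -> : a * q ^+ 2 = \sum_(v : Y * K) a * #|[set y | c y == v.2]|%:R.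
  rewrite -(pair_bigA _ (fun (_ : Y) j => a * #|[set y | c y == j]|%:R)) /=.
  by rewrite sumr_const -mulr_sumr -natr_sum sum_card_fibre -[RHS]mulr_natr expr2 mulrA.
apply: (card_by_key (key := fun p => (f p, c (pr p)))) => -[x j].
set S := finset _.
have SP p : p \in S -> [/\ p \in D, f p = x & c (pr p) = j].
  by rewrite 2!inE xpair_eqE => /andP[/andP[-> _] /andP[/eqP -> /eqP ->]].
have [->|/set0Pn[p Sp]] := eqVneq S set0; first by rewrite cards0 mulr_ge0 // ltW.
have [_ fp cp] := SP p Sp.
move: Sp; rewrite 2!inE fp cp /= => /andP[/andP[_ /ltW le_a] _]; apply: le_trans le_a.
by rewrite ler_nat (card_same_key pr_inj pr_ends).
Qed.

Let poor1 := [set p in D | #|N1 (f p) (c1 p.1)|%:R < a * #|[set y | c1 y == c1 p.1]|%:R].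
Let poor2 := [set p in D | #|N2 (f p) (c2 p.2)|%:R < a * #|[set z | c2 z == c2 p.2]|%:R].

Let card_poor1 : #|poor1|%:R <= a * q ^+ 2.
Proof. exact: card_poor left_inj (@mem_left_ends _ _ _). Qed.

Let card_poor2 : #|poor2|%:R <= a * q ^+ 2.
Proof. exact: card_poor right_inj (@mem_right_ends _ _ _). Qed.

Let rich := [set p in D | a / 2 * #|W (f p) (key p)|%:R <= #|D :&: W (f p) (key p)|%:R].

(** Double counting: an edge p of [D] lies in one rectangle for each colour of [closing D f p]. *)
Let sum_W : \sum_(xv : Y * (K * K)) #|D :&: W xv.1 xv.2|%:R <= m%:R * q ^+ 2.
Proof.
rewrite -natr_sum /q -natrX -natrM ler_nat.
have -> : (\sum_(xv : Y * (K * K)) #|D :&: W xv.1 xv.2| = \sum_(p in D) #|closing D f p|)%N.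
  rewrite -(pair_bigA _ (fun x v => #|D :&: W x v|)) /=.
  transitivity (\sum_x \sum_(p in D) (x \in closing D f p))%N.
    apply: eq_bigr => x _; transitivity (#|[set p in D | x \in closing D f p]|).
      rewrite -sum1_card (partition_big key xpredT) //=; apply: eq_bigr => v _.
      rewrite -sum1_card; apply: eq_bigl => p; rewrite !inE.
      by case: (p \in D) (key p == v) => [] [] /=; rewrite ?andbT ?andbF.
    by rewrite -sum1dep_card -big_mkcondr.
  rewrite exchange_big; apply: eq_bigr => p _.
  by rewrite -sum1_card [RHS]big_mkcond; apply: eq_bigr => x _; case: (_ \in _).
apply: (@leq_trans (\sum_(p in D) m)%N); first exact: leq_sum.
rewrite sum_nat_const mulnC leq_mul2l -mulnn -card_prod max_card orbT //.
Qed.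

(** For a fixed colour and cell the rich edges form a matching inside [W], so the square of their
    number is at most the size of [W], which richness and [sum_W] control. *)
Let card_rich : #|rich|%:R <= a * q ^+ 2 + (2 * m%:R / a ^+ 2) * #|K|%:R ^+ 2 * q.
Proof.
(* This weight makes the quadratic terms sum to at most a q^2; the terms [l^-1], one per colour and
   cell, are only linear in q. *)
pose l := a ^+ 2 / (2 * m%:R).
have m0 : 0 < m%:R :> R by rewrite ltr0n.
have l0 : 0 < l by rewrite divr_gt0 ?exprn_gt0 // mulr_gt0.
pose M (xv : Y * (K * K)) := l * (2 / a) * #|D :&: W xv.1 xv.2|%:R + l^-1.
have : #|rich|%:R <= \sum_xv M xv.
  apply: (card_by_key (key := fun p => (f p, key p))) => -[x v].
  set S := [set p in rich | _]; rewrite /M /=.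
  have [->|/set0Pn[p]] := eqVneq S set0.
    rewrite cards0; apply: addr_ge0; last by rewrite invr_ge0 ltW.
    by apply: mulr_ge0 => //; apply: mulr_ge0; [exact: ltW | apply: divr_ge0 => //; exact: ltW].
  rewrite 2!inE xpair_eqE => /andP[/andP[_ rich_p] /andP[/eqP fp /eqP kp]].
  rewrite fp kp in rich_p.
  have SP p1 : p1 \in S -> [/\ p1 \in D, f p1 = x & key p1 = v].
    by rewrite 2!inE xpair_eqE => /andP[/andP[-> _] /andP[/eqP -> /eqP ->]].
  have S1 : (#|S| <= #|N1 x v.1|)%N.
    by apply: (card_same_key left_inj (@mem_left_ends _ _ _)) => p1 /SP[D1 f1 <-].
  have S2 : (#|S| <= #|N2 x v.2|)%N.
    by apply: (card_same_key right_inj (@mem_right_ends _ _ _)) => p1 /SP[D1 f1 <-].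
  have SS : #|S|%:R ^+ 2 <= #|W x v|%:R :> R.
    by rewrite -natrX ler_nat card_W -mulnn leq_mul.
  have {}SS : #|S|%:R ^+ 2 <= 2 / a * #|D :&: W x v|%:R :> R.
    apply: le_trans SS _; rewrite -(ler_pM2l (divr_gt0 a_gt0 (ltr0n R 2))).
    by rewrite mulrA (_ : a / 2 * (2 / a) = 1) ?mul1r //; field; rewrite gt_eqF.
  apply: (@le_trans _ _ (l * #|S|%:R ^+ 2 + l^-1)); last first.
    by rewrite lerD2r -mulrA ler_pM2l.
  (* t <= l * t ^ 2 + l^-1 *)
  set t := #|S|%:R; have : 0 <= (l * t - 1 / 2) ^+ 2 / l + 3 / 4 / l.
    by rewrite addr_ge0 // divr_ge0 ?sqr_ge0 // ?ltW //; lra.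
  by rewrite (_ : _ + _ = l * t ^+ 2 + l^-1 - t) ?subr_ge0 //; field; rewrite gt_eqF.
move=> /le_trans -> //; rewrite big_split /= -mulr_sumr sumr_const !card_prod.
apply: lerD.
  rewrite (_ : l * (2 / a) = a / m%:R); last by rewrite /l; field; rewrite !gt_eqF.
  by rewrite -mulrA ler_pM2l // mulrC ler_pdivrMr // mulrC sum_W.
rewrite -[X in X <= _]mulr_natr !natrM /l invf_div -/q.
by rewrite mulrA [X in _ <= X]mulrAC -!mulrA.
Qed.

Let rest := D :\: (sparse :|: poor1 :|: poor2 :|: rich).

Let card_rest : #|D|%:R - 4 * a * q ^+ 2 - (2 * m%:R / a ^+ 2) * #|K|%:R ^+ 2 * q
  <= #|rest|%:R.
Proof.
have : (#|D| <= #|rest| + (#|sparse| + #|poor1| + #|poor2| + #|rich|))%N.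
  rewrite -[X in (X <= _)%N](cardsID (sparse :|: poor1 :|: poor2 :|: rich)) addnC leq_add2l.
  apply: leq_trans (subset_leq_card (subsetIr _ _)) _.
  do 3?[apply: leq_trans (leq_card_setU _ _) _; rewrite leq_add2r].
  by [].
rewrite -(ler_nat R) !natrD.
move: card_sparse card_poor1 card_poor2 card_rich; lra.
Qed.

Variable phi : K * K -> R.
Hypothesis phi_mean : forall v, phi v * #|cell v|%:R = #|D :&: cell v|%:R.

(** Any remaining edge of a cell supplies a rectangle filling a proportion a^2 of it, where [D] has
    density below a/2 against at least a on the cell. *)
Let wit v := [pick p in rest | key p == v].
Let U v := if wit v is Some p then W (f p) v else set0.

Let restP p v : p \in rest -> key p = v ->
  [/\ a * #|cell v|%:R <= #|D :&: cell v|%:R, a ^+ 2 * #|cell v|%:R <= #|W (f p) v|%:R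
    & #|D :&: W (f p) v|%:R < a / 2 * #|W (f p) v|%:R].
Proof.
move=> + <-; rewrite !in_setD !in_setU 4!inE => /andP[] /[swap] Dp; rewrite Dp /=.
rewrite !negb_or -!leNgt -ltNge => /andP[/andP[/andP[h1 h2] h3] h4]; split=> //.
rewrite card_W card_cell !natrM expr2 mulrACA /=.
by apply: ler_pM => //; rewrite mulr_ge0 // ltW.
Qed.

Let card_rest_U : a ^+ 2 * #|rest|%:R <= \sum_v #|U v|%:R.
Proof.
rewrite -ler_pdivlMl ?exprn_gt0 // mulr_sumr; apply: (card_by_key (key := key)) => v.
rewrite ler_pdivlMl ?exprn_gt0 //.
rewrite /U /wit; case: pickP => [p /andP[p_rest /eqP key_p]|no].
  have [_ + _] := restP p_rest key_p; apply: le_trans.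
  rewrite ler_pM2l ?exprn_gt0 // ler_nat; apply/subset_leq_card/subsetP => p'.
  by rewrite !inE => /andP[_ ->].
rewrite (_ : [set _ in _ | _] = set0) ?cards0 ?mulr0 //.
by apply/setP => p; rewrite !inE; have := no p; rewrite !inE.
Qed.

Lemma increment : exists (K' : finType) (c1' c2' : Y -> K') (phi' : K' * K' -> R),
  #|K'| = (#|K| * 2 ^ #|K| ^ 2)%N /\
  \sum_p ((p \in D)%:R - phi' (c1' p.1, c2' p.2)) ^+ 2 <=
  \sum_p ((p \in D)%:R - phi (c1 p.1, c2 p.2)) ^+ 2 - a ^+ 4 / 4 *
   (#|D|%:R - 4 * a * q ^+ 2 - (2 * m%:R / a ^+ 2) * #|K|%:R ^+ 2 * q).
Proof.
(* The Boolean function records on which chosen rectangles' sides y lies, so the labels of both ends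
   decide membership in [U]. *)
pose c1' y := (c1 y, [ffun v => if wit v is Some p then y \in left_ends D f (f p) else false]).
pose c2' y := (c2 y, [ffun v => if wit v is Some p then y \in right_ends D f (f p) else false]).
pose phi' (v : (K * {ffun K * K -> bool}) * (K * {ffun K * K -> bool})) : R :=
  phi (v.1.1, v.2.1) -
  a / 2 * (v.1.2 (v.1.1, v.2.1) && v.2.2 (v.1.1, v.2.1))%:R.
exists (K * {ffun K * K -> bool})%type, c1', c2', phi'; split.
  by rewrite card_prod card_ffun card_bool card_prod mulnn.
have phi'E p : phi' (c1' p.1, c2' p.2) = phi (key p) - a / 2 * (p \in U (key p))%:R.
  rewrite /phi' /= !ffunE /U /key /=; case: (wit _) => [p'|]; last by rewrite inE.
  by rewrite !inE /key eqxx.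
apply: (@le_trans _ _ (\sum_p ((p \in D)%:R - phi (key p)) ^+ 2 -
    a ^+ 2 / 4 * \sum_v #|U v|%:R)); last first.
  rewrite lerD2l lerN2.
  rewrite (_ : a ^+ 4 / 4 = a ^+ 2 / 4 * a ^+ 2); last by field.
  rewrite -mulrA ler_pM2l; last by rewrite divr_gt0 ?exprn_gt0 // ltr0n.
  apply: le_trans card_rest_U.
  by rewrite ler_pM2l ?exprn_gt0 // card_rest.
rewrite -lerBlDl -sumrB mulr_sumr -sumrN.
rewrite (partition_big key xpredT) //=; apply: ler_sum => v _.
(* Lowering [phi v] by a/2 on [U v] changes the sum by at most -a^2/4 times the size of [U v], as
   [phi v] is at least a. *)
have -> : \sum_(p | key p == v) (((p \in D)%:R - phi' (c1' p.1, c2' p.2)) ^+ 2 -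
    ((p \in D)%:R - phi (key p)) ^+ 2) =
  \sum_(p in U v) (a * (p \in D)%:R + (a ^+ 2 / 4 - a * phi v)).
  rewrite [RHS](eq_bigl (fun p => (key p == v) && (p \in U v))); last first.
    move=> p; rewrite /U; case: (wit v) => [p'|]; rewrite !inE ?andbF //.
    by case: (key p == v).
  rewrite [RHS]big_mkcondr /=; apply: eq_bigr => p /eqP key_p.
  by rewrite phi'E key_p; case: (p \in U v); rewrite /=; field.
rewrite big_split /= -mulr_sumr sumr_const -mulr_natr.
have -> : \sum_(p in U v) (p \in D)%:R = #|D :&: U v|%:R :> R.
  rewrite -natr_sum -sum1_card -big_mkcondr; congr _%:R.
  by apply: eq_bigl => p; rewrite inE andbC.
rewrite /U /wit; case: pickP => [p /andP[p_rest /eqP key_p]|no]; last first.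
  by rewrite setI0 !cards0; lra.
have [h1 h2 h3] := restP p_rest key_p.
have cell0 : 0 < #|cell v|%:R :> R.
  by rewrite ltr0n; apply/card_gt0P; exists p; rewrite inE key_p.
have phi_a : a <= phi v by rewrite -(ler_pM2r cell0) phi_mean.
have W0 : 0 <= #|W (f p) v|%:R :> R by [].
have : a * #|D :&: W (f p) v|%:R <= a * (a / 2 * #|W (f p) v|%:R) by rewrite ler_pM2l // ltW.
have : a * a * #|W (f p) v|%:R <= a * phi v * #|W (f p) v|%:R.
  by apply: ler_wpM2r => //; rewrite ler_pM2l.
lra.
Qed.

End Increment.

(** * Iterating the refinement *)

Lemma sum_sqr_mean_le (R : realFieldType) (T L : finType) (S : {set T}) (key : T -> L)
    (phi mu : L -> R) :
  (forall v, mu v * #|[set p | key p == v]|%:R = #|S :&: [set p | key p == v]|%:R) ->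
  \sum_p ((p \in S)%:R - mu (key p)) ^+ 2 <= \sum_p ((p \in S)%:R - phi (key p)) ^+ 2.
Proof.
move=> mean; rewrite -subr_ge0 -sumrB (partition_big key xpredT) //=.
apply: sumr_ge0 => v _; pose d := mu v - phi v.
rewrite (eq_bigr (fun p => 2 * d * ((p \in S)%:R - mu v) + d ^+ 2)); last first.
  by move=> p /eqP ->; rewrite /d; ring.
rewrite big_split /= -mulr_sumr sumrB.
have -> : \sum_(p | key p == v) (p \in S)%:R = #|S :&: [set p | key p == v]|%:R :> R.
  rewrite -natr_sum -sum1_card -big_mkcondr; congr _%:R.
  by apply: eq_bigl => p; rewrite !inE andbC.
have -> : \sum_(p | key p == v) mu v = mu v * #|[set p | key p == v]|%:R.
  by rewrite sumr_const cardsE mulr_natr.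
by rewrite mean subrr mulr0 add0r; apply: sumr_ge0 => p _; apply: sqr_ge0.
Qed.

(** Induction on s for all k: a k-part step function is one unit farther away than its refinement,
    which has k * 2 ^ k ^ 2 parts. *)
Lemma descent (R : archiRealFieldType) (e : R) (m : nat) : 0 < e -> (0 < m)%N ->
  forall s k : nat, exists q0 : nat, forall (Y K : finType) (D : {set Y * Y})
    (f : Y * Y -> Y) (c1 c2 : Y -> K) (phi : K * K -> R),
  (q0 <= #|Y|)%N -> #|K| = k -> proper_colouring D f ->
  (forall p, p \in D -> (#|closing D f p| <= m)%N) ->
  e * #|Y|%:R ^+ 2 <= #|D|%:R ->
  s%:R * ((e / 10) ^+ 4 / 4 * (e / 2)) * #|Y|%:R ^+ 2
    <= \sum_p ((p \in D)%:R - phi (c1 p.1, c2 p.2)) ^+ 2.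
Proof.
move=> e_gt0 m_gt0; elim=> [|s IH] k.
  by exists 0%N => *; rewrite !mul0r; apply: sumr_ge0 => p _; apply: sqr_ge0.
have [q1 {}IH] := IH (k * 2 ^ k ^ 2)%N.
(* For large q the linear term is at most a q^2, so the losses 4a + a leave e/2 of the density. *)
pose a := e / 10; have a_gt0 : 0 < a by rewrite /a; lra.
pose C : R := 2 * m%:R / a ^+ 2 * k%:R ^+ 2.
exists (maxn q1 (Num.bound (C / a))) => Y K D f c1 c2 phi.
rewrite geq_max => /andP[q1_le C_le] cardK f_proper few dense.
pose key (p : Y * Y) := (c1 p.1, c2 p.2).
pose mu v : R := #|D :&: [set p | key p == v]|%:R / #|[set p | key p == v]|%:R.
have mu_mean v : mu v * #|[set p | key p == v]|%:R = #|D :&: [set p | key p == v]|%:R.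
  have [c0|c_neq0] := eqVneq #|[set p | key p == v]| 0%N; last first.
    by rewrite /mu divfK // pnatr_eq0.
  by rewrite c0 mulr0 (cards0_eq c0) setI0 cards0.
(* [increment] needs cell densities; passing to them only lowers the distance. *)
apply: le_trans (sum_sqr_mean_le phi mu_mean).
have [K' [c1' [c2' [phi' [cardK' V_le]]]]] := increment a_gt0 m_gt0 f_proper few mu_mean.
rewrite cardK in cardK' V_le.
have := IH _ _ _ _ c1' c2' phi' q1_le cardK' f_proper few dense.
move=> /le_trans /(_ V_le); rewrite -/C -/a.
set V := \sum_p _; set q : R := #|Y|%:R in dense *.
have q_ge0 : 0 <= q by [].
have C_ge0 : 0 <= C / a by rewrite /C; do ?[apply: mulr_ge0 => //]; rewrite ?invr_ge0 ?ltW // exprn_gt0.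
have Cq : C * q <= a * q ^+ 2.
  rewrite expr2 mulrA ler_wpM2r // mulrC -ler_pdivrMr //.
  by apply: le_trans (ltW (archi_boundP C_ge0)) _; rewrite ler_nat.
have : a ^+ 4 / 4 * (e / 2 * q ^+ 2) <= a ^+ 4 / 4 * (#|D|%:R - 4 * a * q ^+ 2 - C * q).
  rewrite ler_pM2l; last by rewrite divr_gt0 ?exprn_gt0 // ltr0n.
  have := sqr_ge0 q; move: dense Cq; rewrite /a; lra.
rewrite -natr1; set g := a ^+ 4 / 4; nra.
Qed.

Lemma dense_proper_colouring_closing (R : archiRealFieldType) (e : R) (m : nat) : 0 < e ->
  exists q0 : nat, forall (Y : finType) (D : {set Y * Y}) (f : Y * Y -> Y),
  (q0 <= #|Y|)%N -> proper_colouring D f -> e * #|Y|%:R ^+ 2 <= #|D|%:R ->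
  exists2 p, p \in D & (m < #|closing D f p|)%N.
Proof.
move=> e_gt0; pose g := (e / 10) ^+ 4 / 4 * (e / 2).
have g_gt0 : 0 < g by rewrite /g mulr_gt0 ?divr_gt0 ?exprn_gt0 ?ltr0n // divr_gt0 ?ltr0n.
have [q0 Hq0] := descent e_gt0 (ltn0Sn m) (Num.bound g^-1) 1.
exists (maxn 1 q0) => Y D f; rewrite geq_max => /andP[Y_gt0 q0_le] f_proper dense.
apply/exists_inP; rewrite -[X in is_true X]negbK negb_exists_in; apply/negP => /forall_inP few.
have {}few p : p \in D -> (#|closing D f p| <= m.+1)%N.
  by move=> /few; rewrite -leqNgt => /leq_trans -> //.
(* The zero function on the trivial partition is at distance at most q^2, below the bound for s >
   1/g. *)
have := Hq0 Y unit D f (fun _ => tt) (fun _ => tt) (fun _ => 0) q0_le card_unit f_proper few dense.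
apply/negP; rewrite -ltNge -/g.
apply: (@le_lt_trans _ _ (#|Y|%:R ^+ 2)).
  rewrite -natrX -mulnn -card_prod -sum1_card natr_sum; apply: ler_sum => p _.
  by rewrite subr0; case: (p \in D); rewrite ?expr1n // expr0n.
rewrite ltr_pMl; last by rewrite exprn_gt0 ?ltr0n.
rewrite -ltr_pdivrMr // div1r archi_boundP // invr_ge0 ltW //.
Qed.

(** * From columns to coloured edges *)

Definition closing_columns (X Y : finType) (f g h : X -> Y) (D : {set X}) b :=
  [set x | [exists a in D, (f a == x) && (g a == g b)] &&
           [exists c in D, (f c == x) && (h c == h b)]].

(** Column x becomes the edge (g x, h x) of colour f x. Linearity in g, h keeps edges distinct; the
    other two pairs of rows make the colouring proper. *)
Lemma dense_linear_closing (R : archiRealFieldType) (e : R) (m : nat) : 0 < e ->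
  exists q0 : nat, forall (X Y : finType) (f g h : X -> Y) (D : {set X}),
  (q0 <= #|Y|)%N ->
  {in D &, forall a b, f a = f b -> g a = g b -> a = b} ->
  {in D &, forall a b, f a = f b -> h a = h b -> a = b} ->
  {in D &, forall a b, g a = g b -> h a = h b -> a = b} ->
  e * #|Y|%:R ^+ 2 <= #|D|%:R ->
  exists2 b, b \in D & (m < #|closing_columns f g h D b|)%N.
Proof.
move=> e_gt0; have [q0 Hq0] := dense_proper_colouring_closing m e_gt0.
exists q0 => X Y f g h D q0_le lin_fg lin_fh lin_gh dense.
pose D' := [set (g x, h x) | x in D].
pose f' p := if [pick x in D | (g x, h x) == p] is Some x then f x else p.1.
have f'E b : b \in D -> f' (g b, h b) = f b.
  move=> Db; rewrite /f'; case: pickP => [a /andP[Da /eqP[ga ha]]|/(_ b)].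
    by rewrite (lin_gh a b).
  by rewrite Db eqxx.
have f'_proper : proper_colouring D' f'.
  move=> p1 p2 /imsetP[a Da ->] /imsetP[b Db ->]; rewrite !f'E //= => fab.
  by case=> [gab|hab]; [rewrite (lin_fg a b) | rewrite (lin_fh a b)].
have cardD' : #|D'| = #|D|.
  by rewrite card_in_imset // => a b Da Db [gab hab]; apply: lin_gh.
have [|p /imsetP[b Db ->] lt_m] := Hq0 Y D' f' q0_le f'_proper; first by rewrite cardD'.
exists b => //; apply: leq_trans lt_m _; apply/subset_leq_card/subsetP => x.
rewrite !inE => /andP[/existsP[z /andP[/imsetP[a Da [ga za]] fa]]].
move=> /existsP[y /andP[/imsetP[c Dc [yc hc]] fc]].
rewrite ga za f'E // in fa; rewrite yc hc f'E // in fc.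
apply/andP; split; apply/exists_inP; [exists a | exists c] => //.
  by rewrite fa ga eqxx.
by rewrite fc hc eqxx.
Qed.

Lemma closing_columnsS (X Y : finType) (f g h : X -> Y) (D E : {set X}) b :
  E \subset D -> closing_columns f g h E b \subset closing_columns f g h D b.
Proof.
move=> /subsetP ED; apply/subsetP => x; rewrite !inE.
move=> /andP[/exists_inP[a /ED Da Ha] /exists_inP[c /ED Dc Hc]].
by apply/andP; split; apply/exists_inP; [exists a | exists c].
Qed.

(** * Frequent columns *)

Definition frequent (X Y : finType) (N : nat) (F : 'I_N -> X -> Y) d :=
  [forall k, (N <= #|[set x | F k x == F k d]|)%N].

(** Charge an infrequent column to a row and symbol where it is rare; each pair receives fewer than
    N columns. The successor counts the key [None]. *)
Lemma card_infrequent (X Y : finType) (N : nat) (F : 'I_N -> X -> Y) :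
  (#|[set d | ~~ frequent F d]| <= (N * #|Y|).+1 * N)%N.
Proof.
pose key d := omap (fun k => (k, F k d)) [pick k | (#|[set x | F k x == F k d]| < N)%N].
have := @card_by_key rat X (option ('I_N * Y)) [set d | ~~ frequent F d] key (fun _ => N%:R).
rewrite sumr_const card_option card_prod card_ord -mulrnA ler_nat mulnC; apply=> v.
rewrite ler_nat; set S := finset _.
have [->|/set0Pn[d]] := eqVneq S set0; first by rewrite cards0.
rewrite !inE negb_forall => /andP[/existsP[k0]]; rewrite -ltnNge => k0_few /eqP key_d.
move: key_d; rewrite {1}/key; case: pickP => [k k_few /= v_def|/(_ k0)]; last by rewrite k0_few.
apply: leq_trans (ltnW k_few); apply/subset_leq_card/subsetP => x.
rewrite !inE => /andP[_]; rewrite /key -v_def; case: pickP => [k' _ /eqP[-> ->]|] //.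
Qed.

(** * Completing a configuration to an unseparated family *)

Lemma uniq_unzip1_inj (S T : eqType) (s : seq (S * T)) x i j :
  uniq (unzip1 s) -> (x, i) \in s -> (x, j) \in s -> i = j.
Proof.
elim: s => //= -[y k] s IH /andP[ys s_uniq]; rewrite !inE !xpair_eqE.
have notin l : x = y -> (x, l) \in s -> False.
  by move=> -> ls; case/negP: ys; apply/mapP; exists (y, l).
case/orP=> [/andP[/eqP xy /eqP ->]|xi]; case/orP=> [/andP[/eqP xy' /eqP ->]|xj] //.
- by case: (notin j xy).
- by case: (notin i xy').
- exact: IH.
Qed.

Section Completion.

Variables (X Y : finType) (t : nat) (w : t.-tuple nat).
Let u := (\sum_(i < t) tnth w i)%N.
Variables (n q : nat) (F : 'I_u -> X -> Y).
Hypothesis F_SHF : is_SHF n q w F.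

Let part (p : X -> option 'I_t) i := [set x | p x == Some i].
Let support (p : X -> option 'I_t) := [set x | p x != None].
Let covered (p : X -> option 'I_t) := [set k | [exists x, exists y,
  [&& p x != None, p y != None, p x != p y & F k x == F k y]]].

Let card_support p : #|support p| = (\sum_i #|part p i|)%N.
Proof.
have -> : (\sum_i #|part p i| = \sum_i \sum_x (p x == Some i))%N.
  by apply: eq_bigr => i _; rewrite -sum1dep_card big_mkcond.
rewrite exchange_big -sum1dep_card big_mkcond; apply: eq_bigr => x _ /=.
case: (p x) => [j|]; last by rewrite big1.
by rewrite (bigD1 j) //= eqxx big1 // => i ij; rewrite (inj_eq Some_inj) eq_sym (negbTE ij).
Qed.

(* [p] is a partial assignment of the columns to the classes C_i; the rows in *)
(* [covered p] cannot separate any extension of it. *)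
Let complete (p : X -> option 'I_t) :
  (forall i, #|part p i| <= tnth w i)%N -> (#|support p| <= #|covered p|)%N ->
  (forall i, exists d j, [/\ frequent F d, p d = Some j & j != i]) -> False.
Proof.
have [m] := ubnP (u - #|support p|); elim: m p => // m IH p.
rewrite ltnS => le_m part_le supp_cov other.
have [w_le|[i]] : (forall i, tnth w i <= #|part p i|)%N \/ exists i, (#|part p i| < tnth w i)%N.
  have [/forallP w_le|] := boolP [forall i, (tnth w i <= #|part p i|)%N]; first by left.
  by rewrite negb_forall => /existsP[i]; rewrite -ltnNge; right; exists i.
  have [_ _] := F_SHF; case/(_ (part p)) => [i|i j ij|k].
  - by apply/eqP; rewrite eqn_leq part_le w_le.
  - rewrite -setI_eq0; apply/eqP/setP => x; rewrite !inE.
    by apply/negP => /andP[/eqP ->] /eqP[ji]; rewrite ji eqxx in ij.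
  (* The classes are full, so the support has u columns and all u rows are covered. *)
  have : k \in covered p.
    suff -> : covered p = setT by rewrite inE.
    apply/eqP; rewrite eqEcard subsetT cardsT card_ord /=.
    by apply: leq_trans supp_cov; rewrite card_support; apply: leq_sum => i _.
  rewrite inE => /existsP[x /existsP[y]].
  case px: (p x) => [i|] //; case py: (p y) => [j|] //= /andP[ij /eqP Fxy].
  move=> /(_ i j); rewrite -(inj_eq Some_inj) ij => /(_ isT); rewrite disjoint_subset.
  move/subsetP/(_ (F k x)); rewrite inE Fxy {1}(_ : F k y = F k x) // !imset_f ?inE ?px ?py ?eqxx //.
  by move=> /(_ isT).
move=> part_lt; have supp_lt : (#|support p| < u)%N.
  rewrite card_support /u (bigD1 i) //= [X in (_ < X)%N](bigD1 i) //= -addSn.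
  by apply: leq_add => //; apply: leq_sum.
have [k k_new] : exists k, (k \notin covered p) || (covered p == setT).
  have [->|] := eqVneq (covered p) setT; last first.
    by rewrite -subTset => /subsetPn[k _ ?]; exists k; apply/orP; left.
  by exists (Ordinal (leq_ltn_trans (leq0n _) supp_lt)); rewrite orbT.
have [d [j [d_freq pd ji]]] := other i.
(* The entry of d occurs at least u times in row k, and fewer than u columns are assigned. *)
have [x] : exists x, x \in [set x | F k x == F k d] :\: support p.
  apply/card_gt0P; rewrite cardsD subn_gt0.
  apply: leq_ltn_trans (subset_leq_card (subsetIr _ _)) _.
  by apply: leq_trans supp_lt (forallP d_freq k).
rewrite !inE negbK => /andP[/eqP px /eqP Fx].
pose p' z := if z == x then Some i else p z.
have p'E z : p z != None -> p' z = p z by rewrite /p'; case: (z =P x) => // ->; rewrite px.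
have supp' : support p' = x |: support p.
  by apply/setP => z; rewrite !inE /p'; case: (z =P x).
have x_new : x \notin support p by rewrite inE px.
have cov_sub : covered p \subset covered p'.
  apply/subsetP => l; rewrite !inE => /existsP[y /existsP[z /and4P[py pz yz Fyz]]].
  by apply/existsP; exists y; apply/existsP; exists z; rewrite !p'E // py pz yz.
have k_cov : k \in covered p'.
  rewrite inE; apply/existsP; exists x; apply/existsP; exists d.
  by rewrite (p'E d) pd // /p' eqxx Fx eqxx (inj_eq Some_inj) [i == j]eq_sym ji.
apply: (IH p').
- rewrite supp' cardsU1 x_new; move: le_m supp_lt; lia.
- move=> l; have [->|li] := eqVneq l i.
    have -> : part p' i = x |: part p i.
      by apply/setP => z; rewrite !inE /p'; case: (z =P x); rewrite ?eqxx.
    by rewrite cardsU1 inE px.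
  have -> // : part p' l = part p l.
  apply/setP => z; rewrite !inE /p'; case: (z =P x) => // ->.
  by rewrite px (inj_eq Some_inj) eq_sym (negbTE li).
- rewrite supp' cardsU1 x_new; case/orP: k_new => [k_new|/eqP all_cov].
    apply: leq_trans (_ : #|k |: covered p| <= _)%N; first by rewrite cardsU1 k_new.
    by apply: subset_leq_card; rewrite subUset sub1set k_cov.
  apply: (leq_trans supp_lt); apply: leq_trans (subset_leq_card cov_sub).
  by rewrite all_cov cardsT card_ord.
- move=> l; have [d' [j' [freq' pd' jl']]] := other l.
  by exists d', j'; rewrite p'E pd'.
Qed.

Lemma no_configuration (s : seq (X * 'I_t)) (ks : seq 'I_u) :
  uniq (unzip1 s) -> uniq ks -> (size s <= size ks)%N ->
  (forall i, count (fun e => e.2 == i) s <= tnth w i)%N ->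
  (forall e, e \in s -> frequent F e.1) ->
  (forall k, k \in ks -> exists e e',
     [/\ e \in s, e' \in s, e.2 != e'.2 & F k e.1 = F k e'.1]) ->
  (exists e e', [/\ e \in s, e' \in s & e.2 != e'.2]) -> False.
Proof.
move=> s_uniq ks_uniq size_le count_le s_freq ks_cov [e1 [e2 [s1 s2 e12]]].
pose p z := [pick i | (z, i) \in s].
have pE e : e \in s -> p e.1 = Some e.2.
  case: e => x i /= es; rewrite /p; case: pickP => [j js|/(_ i)]; last by rewrite es.
  by congr Some; apply: uniq_unzip1_inj s_uniq js es.
have p_some x i : p x = Some i -> (x, i) \in s.
  by rewrite /p; case: pickP => // j js [<-].
apply: (@complete p).
- move=> i; apply: leq_trans (count_le i); rewrite -size_filter -(size_map fst).
  apply: leq_trans (card_size _); apply/subset_leq_card/subsetP => x.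
  rewrite inE => /eqP/p_some xs; apply/mapP; exists (x, i) => //.
  by rewrite mem_filter eqxx.
- apply: (@leq_trans (size s)).
    rewrite -(size_map fst); apply: leq_trans (card_size _).
    apply/subset_leq_card/subsetP => x; rewrite inE.
    by case px: (p x) => [i|] // _; apply/mapP; exists (x, i) => //; apply: p_some.
  apply: leq_trans size_le _; rewrite -(card_uniqP ks_uniq).
  apply/subset_leq_card/subsetP => k /ks_cov[e [e' [se se' ee' Fe]]].
  rewrite inE; apply/existsP; exists e.1; apply/existsP; exists e'.1.
  by rewrite !pE // (inj_eq Some_inj) ee' Fe eqxx.
- move=> i; have [->|e1i] := eqVneq i e1.2.
    by exists e2.1, e2.2; rewrite s_freq // pE // eq_sym.
  by exists e1.1, e1.2; rewrite s_freq // pE // eq_sym.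
Qed.

End Completion.

(** * Forbidden triangles and 4-cycles *)

Theorem theorem4p1 (R : realType) (t : nat) (w : t.-tuple nat)
  (t_gt0 : (0 < t)%N)
  (w_gt0 : forall i : 'I_t, (0 < tnth w i)%N)
  (tw : (3 <= t)%N \/ t = 2%N /\ (2 <= minn (nth 0%N w 0) (nth 0%N w 1))%N) :
  forall eps : R, 0 < eps ->
  exists q0 : nat, forall q : nat, (q0 <= q)%N ->
  forall (n : nat) (X Y : finType)
    (F : 'I_(\sum_(i < t) tnth w i)%N -> X -> Y),
  is_SHF n q w F -> n%:R <= eps * q%:R ^+ 2.
Proof.
move=> eps eps_gt0; have e2_gt0 : 0 < eps / 2 by lra.
have e4_gt0 : 0 < eps / 4 by lra.
have [q1 Hq1] := dense_linear_closing 1 e2_gt0.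
have [q2 Hq2] := dense_linear_closing 3 e4_gt0.
have [q3 Hq3] := dense_linear_closing 1 e4_gt0.
set u := (\sum_(i < t) tnth w i)%N.
exists (maxn (maxn q1 q2) (maxn q3 (maxn 1 (Num.bound (4 * u%:R ^+ 2 / eps))))).
move=> q; rewrite !geq_max => /andP[/andP[q1_le q2_le] /and3P[q3_le q_gt0 u_le]].
move=> n X Y F F_SHF; rewrite leNgt; apply/negP => n_gt.
have [cardX cardY _] := F_SHF.
have t_ge2 : (2 <= t)%N by case: tw => [/ltnW //|[t2 _]]; rewrite t2.
have u_ge_t : (t <= u)%N.
  rewrite -[X in (X <= _)%N]card_ord -sum1_card; apply: leq_sum => i _; exact: w_gt0.
pose D := [set d | frequent F d].
(* At most (uq + 1)u <= 2u^2 q columns are infrequent, which is at most eps/2 q^2 once 4u^2 <= eps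
   q. *)
have D_dense : eps / 2 * q%:R ^+ 2 <= #|D|%:R.
  have : (n <= #|D| + (u * q).+1 * u)%N.
    rewrite -cardX -(cardsC D) leq_add2l -cardY; apply: leq_trans (card_infrequent F).
    by apply/subset_leq_card/subsetP => x; rewrite !inE.
  rewrite -(ler_nat R) natrD natrM -natr1 natrM => n_le.
  have u1 : 1 <= u%:R :> R by rewrite ler1n; apply: leq_trans u_ge_t.
  have q_ge1 : 1 <= q%:R :> R by rewrite ler1n.
  have : 4 * u%:R ^+ 2 <= eps * q%:R.
    rewrite -ler_pdivrMl // mulrC.
    have ge0 : 0 <= 4 * u%:R ^+ 2 / eps by rewrite divr_ge0 ?mulr_ge0 ?exprn_ge0 // ltW.
    by apply: le_trans (ltW (archi_boundP ge0)) _; rewrite ler_nat.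
  nra.
have Dfreq d : d \in D -> frequent F d by rewrite inE.
pose i0 : 'I_t := Ordinal (leq_trans (isT : (0 < 2)%N) t_ge2).
pose i1 : 'I_t := Ordinal (leq_trans (isT : (1 < 2)%N) t_ge2).
have linear : forall k k', k != k' -> {in D &, forall a b, F k a = F k b -> F k' a = F k' b -> a = b}.
  move=> k k' kk' a b Da Db Fk Fk'; apply/eqP/negP => /negP ab.
  apply: (no_configuration F_SHF (s := [:: (a, i0); (b, i1)]) (ks := [:: k; k'])).
  - by rewrite /= inE ab.
  - by rewrite /= inE kk'.
  - by [].
  - move=> i; apply: leq_trans (w_gt0 i); rewrite /= addn0.
    by case: i => [[|[|i]] lti].
  - by move=> e; rewrite !inE => /orP[] /eqP ->; apply: Dfreq.
  - move=> l; rewrite !inE => kl; exists (a, i0), (b, i1).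
    by rewrite !inE !eqxx orbT; split=> //; case/orP: kl => /eqP ->.
  - by exists (a, i0), (b, i1); rewrite !inE !eqxx orbT.
case: tw => [t_ge3|[t2 w_ge2]].
  have ltu k : (k < 3)%N -> (k < u)%N by move=> k3; apply: leq_trans (leq_trans k3 t_ge3) u_ge_t.
  pose k1 : 'I_u := Ordinal (ltu 0 isT); pose k2 : 'I_u := Ordinal (ltu 1 isT).
  pose k3 : 'I_u := Ordinal (ltu 2 isT).
  pose i2 : 'I_t := Ordinal t_ge3.
  (* With m = 1 there is a closing symbol besides that of b itself. *)
  have [|||||b Db closing_gt1] := Hq1 X Y (F k1) (F k2) (F k3) D; rewrite ?cardY //; try exact: linear.
  have [x] : exists x, x \in closing_columns (F k1) (F k2) (F k3) D b :\ F k1 b.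
    by apply/card_gt0P; move: closing_gt1; rewrite (cardsD1 (F k1 b)); case: (_ \in _) => //= /ltnW.
  rewrite !inE => /and3P[xb /exists_inP[a Da /andP[/eqP ax /eqP ab]]].
  move=> /exists_inP[c Dc /andP[/eqP cx /eqP cb]].
  have a_neq_b : a != b by apply: contraNneq xb => <-; rewrite ax.
  have c_neq_b : c != b by apply: contraNneq xb => <-; rewrite cx.
  have a_neq_c : a != c.
    apply: contraNneq a_neq_b => ac; apply/eqP; apply: (linear k2 k3) => //.
    by rewrite ac.
  apply: (no_configuration F_SHF (s := [:: (a, i0); (b, i1); (c, i2)]) (ks := [:: k1; k2; k3])).
  - by rewrite /= !inE negb_or a_neq_b a_neq_c eq_sym c_neq_b.
  - by [].
  - by [].
  - move=> i; apply: leq_trans (w_gt0 i); rewrite /= addn0.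
    by case: i => [[|[|[|i]]] lti].
  - by move=> e; rewrite !inE => /or3P[] /eqP ->; apply: Dfreq.
  - move=> l; rewrite !inE => /or3P[] /eqP ->.
    + by exists (a, i0), (c, i2); rewrite !inE !eqxx !orbT ax cx.
    + by exists (a, i0), (b, i1); rewrite !inE !eqxx !orbT ab.
    + by exists (c, i2), (b, i1); rewrite !inE !eqxx !orbT cb.
  - by exists (a, i0), (b, i1); rewrite !inE !eqxx orbT.
have w_ge2' i : (2 <= tnth w i)%N.
  move: w_ge2; rewrite leq_min => /andP[w0 w1]; rewrite (tnth_nth 0%N).
  by case: i => [[|[|i]] lti] //=; exfalso; have := lti; rewrite t2.
have u_ge4 : (4 <= u)%N.
  have -> : 4%N = (\sum_(i < t) 2)%N by rewrite sum_nat_const card_ord t2.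
  exact: leq_sum.
have ltu k : (k < 4)%N -> (k < u)%N by move=> k4; apply: leq_trans k4 u_ge4.
pose k1 : 'I_u := Ordinal (ltu 0 isT); pose k2 : 'I_u := Ordinal (ltu 1 isT).
pose k3 : 'I_u := Ordinal (ltu 2 isT); pose k4 : 'I_u := Ordinal (ltu 3 isT).
(* More than 3, so that a symbol of row 1 can later avoid those of three columns. *)
pose E := [set b in D | 3 < #|closing_columns (F k1) (F k2) (F k3) D b|]%N.
have ED : E \subset D by apply/subsetP => b; rewrite inE => /andP[].
have linear' (G : {set X}) (k k' : 'I_u) : G \subset D -> k != k' ->
    {in G &, forall a b, F k a = F k b -> F k' a = F k' b -> a = b}.
  by move=> /subsetP GD kk' a b /GD Da /GD Db; apply: linear.
(* Otherwise [D :\: E] is dense and contains a column with more than 3 closing symbols, which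
   belongs to [E]. *)
have E_dense : eps / 4 * q%:R ^+ 2 <= #|E|%:R.
  rewrite leNgt; apply/negP => E_small.
  have DE : D :\: E \subset D := subsetDl D E.
  have [|||||b DEb] := Hq2 X Y (F k1) (F k2) (F k3) (D :\: E);
    rewrite ?cardY //; try exact: linear'.
    move: D_dense E_small; rewrite -(cardsID E D) natrD (setIidPr ED).
    set dE := #|E|%:R; set dD := #|D :\: E|%:R; lra.
  move=> /leq_trans/(_ (subset_leq_card (closing_columnsS _ _ _ b DE))) b_gt.
  by move: DEb; rewrite !inE b_gt andbT; case: (frequent F b).
have [|||||b Eb closing_gt1] := Hq3 X Y (F k4) (F k2) (F k3) E; rewrite ?cardY //; try exact: linear'.
have Db := subsetP ED b Eb.
have [x] : exists x, x \in closing_columns (F k4) (F k2) (F k3) E b :\ F k4 b.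
  by apply/card_gt0P; move: closing_gt1; rewrite (cardsD1 (F k4 b)); case: (_ \in _) => //= /ltnW.
rewrite in_setD1 [in X in _ && X]inE => /and3P[xb /exists_inP[a Ea /andP[/eqP ax /eqP ab]]].
move=> /exists_inP[c Ec /andP[/eqP cx /eqP cb]].
have Da := subsetP ED a Ea; have Dc := subsetP ED c Ec.
have [y] : exists y, y \in closing_columns (F k1) (F k2) (F k3) D b :\: [set F k1 a; F k1 b; F k1 c].
  apply/card_gt0P; rewrite cardsD subn_gt0.
  apply: leq_ltn_trans (subset_leq_card (subsetIr _ _)) _.
  move: Eb; rewrite inE => /andP[_]; apply: leq_trans; rewrite ltnS.
  by rewrite -setUA !cardsU1 cards1; do 2!case: (_ \notin _).
rewrite !inE !negb_or -!andbA => /and4P[ya yb yc].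
move=> /andP[/exists_inP[a' Da' /andP[/eqP ay /eqP ab']] /exists_inP[c' Dc' /andP[/eqP cy /eqP cb']]].
have a_neq_b : a != b by apply: contraNneq xb => <-; rewrite ax.
have a_neq_c : a != c.
  apply: contraNneq a_neq_b => ac; apply/eqP; apply: (linear k2 k3) => //.
  by rewrite ac.
have a'_neq_a : a' != a by apply: contraNneq ya => <-; rewrite ay.
have a'_neq_b : a' != b by apply: contraNneq yb => <-; rewrite ay.
have a'_neq_c : a' != c by apply: contraNneq yc => <-; rewrite ay.
have c'_neq_a : c' != a by apply: contraNneq ya => <-; rewrite cy.
have c'_neq_c : c' != c by apply: contraNneq yc => <-; rewrite cy.
have a'_neq_c' : a' != c'.
  apply: contraNneq a'_neq_b => ac; apply/eqP; apply: (linear k2 k3) => //.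
  by rewrite ac.
(* Column b is only a hub: a and a' agree with it in row 2, c and c' in row 3. The cycle a', c', c,
   a alternates classes and collides in rows 1, 3, 4, 2. *)
apply: (no_configuration F_SHF (s := [:: (a, i0); (c', i0); (c, i1); (a', i1)])
  (ks := [:: k1; k2; k3; k4])).
- rewrite /= !inE !negb_or eq_sym c'_neq_a a_neq_c [a == a']eq_sym a'_neq_a c'_neq_c.
  by rewrite [c' == a']eq_sym a'_neq_c' [c == a']eq_sym a'_neq_c.
- by [].
- by [].
- move=> i; apply: leq_trans (w_ge2' i); rewrite /= addn0.
  by case: i => [[|[|i]] lti].
- by move=> e; rewrite !inE => /or4P[] /eqP ->; apply: Dfreq.
- move=> l; rewrite !inE => /or4P[] /eqP ->.
  + by exists (a', i1), (c', i0); rewrite !inE !eqxx !orbT ay cy.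
  + by exists (a', i1), (a, i0); rewrite !inE !eqxx !orbT ab ab'.
  + by exists (c', i0), (c, i1); rewrite !inE !eqxx !orbT cb cb'.
  + by exists (a, i0), (c, i1); rewrite !inE !eqxx !orbT ax cx.
- by exists (a, i0), (c, i1); rewrite !inE !eqxx !orbT.
Qed.
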